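(* Let $\mathcal F=(\mathbb X;f_1,\dots,f_N)$ be a contractive and injective iterated function system on a complete metric space $\mathbb X$, with attractor $A$ and coding map $\pi:\Omega\to A$. 1. If $M$ is a mask, then $\tau_M$ is a shift invariant section of $\pi$. 2. If $\tau$ is a shift invariant section of $\pi$, then $\tau=\tau_M$ for some mask $M$.
   Context: An iterated function system (IFS) $\mathcal F=(\mathbb X;f_1,\dots,f_N)$ consists of continuous maps $f_i:\mathbb X\to\mathbb X$ on a complete metric space $\mathbb X$. It is contractive if each $f_i$ is a contraction (there is $0\le s<1$ with $d(f_i(x),f_i(y))\le s\,d(x,y)$ for all $x,y$), and injective if each $f_i$ is injective. A contractive IFS has a unique attractor: the nonempty compact $A\subset\mathbb X$ with $A=\bigcup_i f_i(A)$ to which $\mathcal F^k(B)$ converges in the Hausdorff metric for every nonempty compact $B$, where $\mathcal F(B)=\bigcup_i f_i(B)$. Let $\Omega=\{1,\dots,N\}^\infty$ be the set of infinite strings; for $\sigma=i_0i_1i_2\cdots\in\Omega$ let $\sigma|_k$ be the string of its first $k$ symbols and $f_{\sigma|_k}=f_{i_0}\circ f_{i_1}\circ\cdots\circ f_{i_{k-1}}$. The coding map is $\pi:\Omega\to A$, $\pi(\sigma)=\lim_{k\to\infty}f_{\sigma|_k}(x)$ (the limit exists and is independent of $x\in\mathbb X$). A section of $\pi$ is a function $\tau:A\to\Omega$ with $\pi\circ\tau=\mathrm{id}_A$; put $\Omega_\tau=\tau(A)$. Let $S:\Omega\to\Omega$ be the shift, $S(n\sigma)=\sigma$. A section $\tau$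 is shift invariant if $\sigma\in\Omega_\tau$ implies $S(\sigma)\in\Omega_\tau$. A mask is a partition $M=\{M_i:1\le i\le N\}$ of $A$ (pairwise disjoint, possibly empty sets with union $A$) such that $M_i\subseteq f_i(A)$ for all $i$. Given a mask $M$, define $T:A\to A$ by $T(x)=f_i^{-1}(x)$ when $x\in M_i$. The itinerary $\tau_M(x)$ of $x\in A$ is the string $i_0i_1i_2\cdots\in\Omega$ where $i_k$ is the unique index with $T^k(x)\in M_{i_k}$. *)

(* Defs.v *)
From HB Require Import structures.
From mathcomp Require Import all_boot all_order all_algebra.
From mathcomp Require Import all_classical all_reals all_analysis.

Set Implicit Arguments.
Unset Strict Implicit.
Unset Printing Implicit Defensive.

Import Order.TTheory GRing.Theory Num.Theory.
Import numFieldNormedType.Exports metricType_numDomainType.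

Local Open Scope classical_set_scope.
Local Open Scope ring_scope.

(* Complete structures of the library carry a base point, so such a space is
   nonempty; this loses nothing below, where an attractor is nonempty. *)
#[short(type="completeMetricType")]
HB.structure Definition CompleteMetric (R : numDomainType) :=
  {X of Metric R X & Complete X}.

(* The symbols 1, ..., N are represented by the ordinals 0, ..., N - 1. *)
Record ifs (R : realType) (X : completeMetricType R) (N : nat) := IFS {
  ifs_map :> 'I_N -> X -> X ;
  ifs_continuous : forall i, continuous (ifs_map i) }.

Definition Omega (N : nat) := nat -> 'I_N.

Definition string_shift (N : nat) (sigma : Omega N) : Omega N := fun k => sigma k.+1.

Section Hausdorff.
Context {R : realType} {X : metricType R}.

Definition dist_to (x : X) (C : set X) : R := inf [set mdist x y | y in C].

(* Only meaningful for nonempty bounded sets, [sup] and [inf] being 0 by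
   convention when they do not exist. *)
Definition hausdorff_dist (B C : set X) : R :=
  Num.max (sup [set dist_to b C | b in B]) (sup [set dist_to c B | c in C]).

End Hausdorff.

Section IFS.
Context {R : realType} {X : completeMetricType R} {N : nat}.
Implicit Types (f : ifs X N) (A B : set X) (sigma : Omega N).

Definition contractive f := forall i,
  exists2 s : R, 0 <= s < 1 &
    forall x y, mdist (f i x) (f i y) <= s * mdist x y.

Definition injective_ifs f := forall i, injective (f i).

Definition hutchinson f B : set X := \bigcup_i (f i @` B).

Definition is_attractor f A :=
  [/\ A !=set0, compact A, A = hutchinson f A &
    forall B, B !=set0 -> compact B ->
      hausdorff_dist (iter k (hutchinson f) B) A @[k --> \oo] --> (0 : R)].

Fixpoint prefix_map f sigma (k : nat) : X -> X :=
  if k is k'.+1 then prefix_map f sigma k' \o f (sigma k') else id.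

(* The choice of the base point is immaterial and the values lie in the
   attractor: see [coding_map_cvg] and [coding_map_attractor]. *)
Definition coding_map f sigma : X :=
  lim (prefix_map f sigma k point @[k --> \oo]).

Definition is_section f A (tau : A -> Omega N) := coding_map f \o tau = val.

Definition shift_invariant A (tau : A -> Omega N) :=
  forall sigma, range tau sigma -> range tau (string_shift sigma).

(* The library's [partition] requires nonempty blocks, hence [trivIset]. *)
Record ifs_mask f A := IFSMask {
  mask_set :> 'I_N -> set X ;
  mask_disjoint : trivIset setT mask_set ;
  mask_cover : \bigcup_i mask_set i = A ;
  mask_sub : forall i, mask_set i `<=` f i @` A }.

End IFS.

Section Itinerary.
Context {R : realType} {X : completeMetricType R} {N : nat}.
Context {f : ifs X N} {A : set X} (M : ifs_mask f A).

Lemma mask_index_subproof (x : A) : exists i, M i (val x).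
Proof.
by have := set_valP x; rewrite -{1}(mask_cover M) => -[i _ Mix]; exists i.
Qed.

Definition mask_index (x : A) : 'I_N := sval (cid (mask_index_subproof x)).

Lemma mask_indexP (x : A) i : M i (val x) <-> mask_index x = i.
Proof.
rewrite /mask_index; case: cid => j /= Mj; split=> [Mi|<-//].
by apply: (@mask_disjoint _ _ _ _ _ M) => //; exists (val x).
Qed.

Lemma mask_map_subproof (x : A) : exists y : A, f (mask_index x) (val y) = val x.
Proof.
have /mask_sub[y Ay fy] : M (mask_index x) (val x) by apply/mask_indexP.
by exists (SigSub (mem_set Ay)).
Qed.

(* When [f] is injective, the chosen preimage is the only one. *)
Definition mask_map (x : A) : A := sval (cid (mask_map_subproof x)).

Lemma mask_mapE (x : A) : f (mask_index x) (val (mask_map x)) = val x.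
Proof. by rewrite /mask_map; case: cid. Qed.

Definition itinerary (x : A) : Omega N := fun k => mask_index (iter k mask_map x).

End Itinerary.

Section Coding.
Context {R : realType} {X : completeMetricType R} {N : nat}.
Context (f : ifs X N) (hf : contractive f).
Implicit Types (sigma : Omega N) (x y : X).

Lemma uniform_ratio : exists2 s : R, 0 <= s < 1 &
  forall i x y, mdist (f i x) (f i y) <= s * mdist x y.
Proof.
have /choice[s hs] : forall i, exists s : R, 0 <= s < 1 /\
    forall x y, mdist (f i x) (f i y) <= s * mdist x y.
  by move=> i; have [s] := hf i; exists s.
exists (\big[Num.max/0]_i s i).
  rewrite bigmax_ge_id/=; apply/bigmax_ltP; split=> // i _.
  by have [/andP[]] := hs i.
move=> i x y; have [_ /(_ x y)/le_trans] := hs i; apply.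
by rewrite ler_wpM2r ?mdist_ge0//; apply: le_bigmax.
Qed.

Lemma prefix_map_dist (s : R) sigma k x y : 0 <= s ->
  (forall i x y, mdist (f i x) (f i y) <= s * mdist x y) ->
  mdist (prefix_map f sigma k x) (prefix_map f sigma k y) <= s ^+ k * mdist x y.
Proof.
move=> s0 fs; elim: k x y => [|k IH] x y /=; first by rewrite expr0 mul1r.
by rewrite (le_trans (IH _ _))// exprSr -mulrA ler_wpM2l ?exprn_ge0.
Qed.

Lemma prefix_mapD sigma k m x : prefix_map f sigma (k + m) x =
  prefix_map f sigma k (prefix_map f (fun j => sigma (k + j)%N) m x).
Proof.
elim: m x => [|m IH] x; first by rewrite addn0.
by rewrite addnS /= IH.
Qed.

Lemma prefix_map_bounded x : exists2 D : R, 0 <= D &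
  forall sigma k, mdist x (prefix_map f sigma k x) <= D.
Proof.
have [s /andP[s0 s1] fs] := uniform_ratio.
pose C := \big[Num.max/0]_i mdist x (f i x).
have C0 : 0 <= C by rewrite bigmax_ge_id.
have s1' : 0 < 1 - s by rewrite subr_gt0.
exists (C / (1 - s)); first by rewrite divr_ge0// ltW.
suff H sigma k y : mdist x y <= C / (1 - s) ->
    mdist x (prefix_map f sigma k y) <= C / (1 - s).
  by move=> sigma k; apply: H; rewrite mdistxx divr_ge0// ltW.
elim: k y => //= k IH y xy; apply: IH.
rewrite (le_trans (metric_triangle _ (f (sigma k) x) _))//.
have -> : C / (1 - s) = C + s * (C / (1 - s)).
  apply: (mulIf (lt0r_neq0 s1')); rewrite mulrDl -!mulrA mulVf ?lt0r_neq0// !mulr1.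
  by rewrite mulrBr mulr1 [s * C]mulrC subrK.
apply: lerD; first exact: le_bigmax.
by rewrite (le_trans (fs _ _ _))// ler_wpM2l.
Qed.

Lemma cvg_geometric_dist (s D : R) (u v : nat -> X) (l : X) : 0 <= s < 1 ->
  (forall k, mdist (u k) (v k) <= s ^+ k * D) ->
  u k @[k --> \oo] --> l -> v k @[k --> \oo] --> l.
Proof.
move=> /andP[s0 s1] uv /cvgrPdist_lt ul; apply/cvgrPdist_lt => e e0.
have e2 : 0 < e / 2 by rewrite divr_gt0.
have : s ^+ k * D @[k --> \oo] --> (0 * D : R).
  by apply: cvgM; [apply: cvg_expr; rewrite ger0_norm | exact: cvg_cst].
rewrite mul0r => /cvgr0Pnorm_lt/(_ _ e2) sD.
near=> k; rewrite (le_lt_trans (metric_triangle _ (u k) _))//.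
rewrite [e]splitr ltrD//; first by near: k; exact: ul.
rewrite (le_lt_trans (uv k))// (le_lt_trans (ler_norm _))//.
by near: k.
Unshelve. all: by end_near. Qed.

Lemma prefix_map_cvg sigma x : cvg (prefix_map f sigma k x @[k --> \oo]).
Proof.
have [s /andP[s0 s1] fs] := uniform_ratio.
have [D D0 xD] := prefix_map_bounded x.
apply/cauchy_cvgP/cauchy_exP => e e0.
have : s ^+ k * D @[k --> \oo] --> (0 * D : R).
  by apply: cvgM; [apply: cvg_expr; rewrite ger0_norm | exact: cvg_cst].
rewrite mul0r => /cvgr0Pnorm_lt/(_ _ e0)[n _ /(_ n (leqnn _)) sD].
exists (prefix_map f sigma n x); exists n => //= m /= nm.
rewrite ballEmdist/= -(subnKC nm) prefix_mapD.
rewrite (le_lt_trans (prefix_map_dist _ _ _ _ s0 fs))//.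
rewrite (le_lt_trans _ sD)// (le_trans _ (ler_norm _))//.
by rewrite ler_wpM2l ?exprn_ge0.
Qed.

Lemma coding_map_cvg sigma x :
  prefix_map f sigma k x @[k --> \oo] --> coding_map f sigma.
Proof.
have [s /andP[s0 s1] fs] := uniform_ratio.
apply: (cvg_geometric_dist (s := s) (D := mdist point x)
  (u := fun k => prefix_map f sigma k point)); first by rewrite s0.
  by move=> k; exact: prefix_map_dist.
exact: prefix_map_cvg.
Qed.

Lemma coding_map_attractor (A : set X) sigma :
  is_attractor f A -> A (coding_map f sigma).
Proof.
move=> [[x Ax] cA AE _].
have fA k y : A y -> A (prefix_map f sigma k y).
  elim: k y => //= k IH y Ay; apply: IH; rewrite AE.
  by exists (sigma k) => //; exists y.
have clA : closed A by apply: compact_closed => //; exact: metric_hausdorff.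
by apply: (closed_cvg A clA _ _ (coding_map_cvg x)); apply: nearW => k; exact: fA.
Qed.

End Coding.

(* Main.v *)
Require Import Defs.
From mathcomp Require Import all_boot all_order all_algebra.
From mathcomp Require Import all_classical all_reals all_analysis.

(** Let [T] be the map of a mask and [sigma] the itinerary of [x]. By the choice
    of [sigma], the composite [f_(sigma|k)] maps [T^k x] back to [x] for every [k]
    ([prefix_map_itinerary]). As [A] is bounded and [f_(sigma|k)] contracts by
    [s ^ k], its value at any base point is therefore within [O(s ^ k)] of [x],
    so that [pi sigma = x]. Shift invariance holds because the shift of the
    itinerary of [x] is the itinerary of [T x].

    Conversely, a shift invariant section [tau] determines its mask: a point
    must belong to the block indexed by the first symbol of its code. The
    self-similarity [pi sigma = f_(sigma 0) (pi (S sigma))] ([coding_map_shift])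
    shows that these blocks form a mask. It also shows, with injectivity of the
    IFS and shift invariance of [tau], that the mask map [T] is conjugate to the
    shift, [tau (T x) = S (tau x)] ([section_mask_map]). Reading off first symbols
    along the orbit of [x] then recovers every symbol of [tau x]. *)


Import Order.TTheory GRing.Theory Num.Theory.
Import numFieldNormedType.Exports metricType_numDomainType.
Local Open Scope classical_set_scope.
Local Open Scope ring_scope.

Lemma mdist_continuous (R : realType) (X : metricType R) (x : X) :
  continuous (mdist x : X -> R^o).
Proof.
move=> y; apply/(@cvgrPdist_lt R R^o) => e e0.
near=> z.
have yz : mdist y z < e.
  by near: z; have := nbhsx_ballx y _ e0; rewrite ballEmdist.
rewrite (le_lt_trans _ yz)//.
have xz : mdist x z <= mdist x y + mdist y z := metric_triangle _ _ _.
have xy : mdist x y <= mdist x z + mdist z y := metric_triangle _ _ _.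
rewrite [mdist z y]metric_sym in xy.
by rewrite ler_norml lerBlDl xz andbT lerNl opprB lerBlDl.
Unshelve. all: by end_near. Qed.

Lemma compact_mdist_bounded (R : realType) (X : metricType R) (A : set X) (x : X) :
  compact A -> exists D : R, forall y, A y -> mdist x y <= D.
Proof.
move=> cA.
have /compact_bounded[D [_ hD]] : compact ((mdist x : X -> R^o) @` A).
  apply: continuous_compact => //; apply: continuous_subspaceT.
  exact: mdist_continuous.
exists (D + 1) => y Ay; rewrite (le_trans (ler_norm _))//.
by apply: hD; [rewrite ltrDl | exists y].
Qed.

Section Coding.
Context {R : realType} {X : completeMetricType R} {N : nat} {f : ifs X N}.
Implicit Types (A : set X) (sigma : Omega N).

(** [prefix_map] adds maps at the inner end, while the shift removes the outermost
    one. *)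
Lemma prefix_mapSl sigma k x :
  prefix_map f sigma k.+1 x =
  f (sigma 0%N) (prefix_map f (string_shift sigma) k x).
Proof. by rewrite -add1n prefix_mapD. Qed.

Lemma coding_map_shift sigma : contractive f ->
  coding_map f sigma = f (sigma 0%N) (coding_map f (string_shift sigma)).
Proof.
move=> hf.
have : f (sigma 0%N) (prefix_map f (string_shift sigma) k point) @[k --> \oo]
    --> coding_map f sigma.
  rewrite -(funext (fun k => prefix_mapSl sigma k point)).
  rewrite (cvg_shiftS (prefix_map f sigma ^~ point)).
  exact: coding_map_cvg.
move/(cvg_unique (@metric_hausdorff _ X)); apply.
apply: continuous_cvg; first exact: ifs_continuous.
exact: coding_map_cvg.
Qed.

Section Mask.
Context {A : set X} (M : ifs_mask f A).

Lemma itinerary_mask_map x :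
  itinerary M (mask_map M x) = string_shift (itinerary M x).
Proof. by apply/funext => k; rewrite /string_shift /itinerary iterSr. Qed.

Lemma prefix_map_itinerary x k :
  prefix_map f (itinerary M x) k (val (iter k (mask_map M) x)) = val x.
Proof.
elim: k x => // k IH x.
by rewrite prefix_mapSl iterSr -itinerary_mask_map IH mask_mapE.
Qed.

Lemma itinerary_section : contractive f -> compact A ->
  is_section f (itinerary M).
Proof.
move=> hf cA; apply/funext => x /=.
have [s /andP[s0 s1] fs] := uniform_ratio hf.
have [D hD] := compact_mdist_bounded _ _ _ point cA.
have := coding_map_cvg hf (sigma := itinerary M x) point.
move/(cvg_unique (@metric_hausdorff _ X)); apply.
apply: (cvg_geometric_dist (s := s) (D := D) (u := fun=> val x)).
- by rewrite s0.
(* Both sides become images under [f_(sigma|k)], of [T^k x] and of the base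
   point, whose distance is at most [D] for every [k]. *)
- move=> k; rewrite -(prefix_map_itinerary x k).
  rewrite (le_trans (prefix_map_dist _ _ _ _ s0 fs))// metric_sym.
  by rewrite ler_wpM2l ?exprn_ge0// hD//; exact: set_valP.
- exact: cvg_cst.
Qed.

Lemma itinerary_shift_invariant : shift_invariant (itinerary M).
Proof.
move=> _ [x _ <-]; exists (mask_map M x) => //; exact: itinerary_mask_map.
Qed.

End Mask.

Section SectionMask.
Context {A : set X} (tau : A -> Omega N).
Hypotheses (hf : contractive f) (fA : is_attractor f A).
Hypothesis tauK : is_section f tau.

Let coding_tau x : coding_map f (tau x) = val x.
Proof. by rewrite -[LHS]/((coding_map f \o tau) x) tauK. Qed.

(** The only possible choice: an itinerary starts with the index of the block
    that contains the point. *)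
Definition section_block (i : 'I_N) : set X := val @` [set x | tau x 0%N = i].

Lemma section_block_disjoint : trivIset setT section_block.
Proof. by move=> i j _ _ [_ [[x <- <-] [y <- /val_inj ->]]]. Qed.

Lemma section_block_cover : \bigcup_i section_block i = A.
Proof.
apply/seteqP; split=> [_ [i _ [x _ <-]]|x Ax]; first exact: set_valP.
by exists (tau (SigSub (mem_set Ax)) 0%N) => //; exists (SigSub (mem_set Ax)).
Qed.

Lemma section_block_sub i : section_block i `<=` f i @` A.
Proof.
move=> _ [x <- <-]; exists (coding_map f (string_shift (tau x))).
  exact: coding_map_attractor.
by rewrite -coding_map_shift.
Qed.

Definition section_mask : ifs_mask f A :=
  IFSMask section_block_disjoint section_block_cover section_block_sub.

Lemma section_mask_index x : mask_index section_mask x = tau x 0%N.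
Proof. by apply/mask_indexP; exists x. Qed.

(** Both [val (T x)] and [pi (S (tau x))] are mapped to [x] by the same injective
    map of the IFS, so they agree; as [S (tau x)] is itself a code chosen by
    [tau], it must be the code of [T x]. *)
Lemma section_mask_map x : injective_ifs f -> shift_invariant tau ->
  tau (mask_map section_mask x) = string_shift (tau x).
Proof.
move=> finj tauS; have [y _ tauy] := tauS _ (ex_intro2 _ _ x I erefl).
rewrite -tauy; congr tau; apply: val_inj.
apply: (finj (mask_index section_mask x)).
by rewrite mask_mapE -(coding_tau y) tauy section_mask_index -coding_map_shift.
Qed.

Lemma itinerary_section_mask : injective_ifs f -> shift_invariant tau ->
  itinerary section_mask = tau.
Proof.
move=> finj tauS; apply/funext => x; apply/funext => k.
elim: k x => [|k IH] x; first exact: section_mask_index.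
by rewrite -[LHS]/(string_shift _ k) -itinerary_mask_map IH section_mask_map.
Qed.

End SectionMask.
End Coding.

Theorem theorem4 (R : realType) (X : completeMetricType R) (N : nat)
    (f : ifs X N) (A : set X) :
  contractive f -> injective_ifs f -> is_attractor f A ->
  (forall M : ifs_mask f A,
     is_section f (itinerary M) /\ shift_invariant (itinerary M)) /\
  (forall tau : A -> Omega N, is_section f tau -> shift_invariant tau ->
     exists M : ifs_mask f A, tau = itinerary M).
Proof.
move=> hf finj fA; split=> [M|tau tauK tauS].
  split; last exact: itinerary_shift_invariant.
  by apply: itinerary_section => //; have [] := fA.
by exists (section_mask tau hf fA tauK); rewrite itinerary_section_mask.
Qed.
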